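(* Let $G$ be a Hausdorff topological group with neutral element $e$. The following statements are equivalent. (1) $\mathscr{F}[G]$ is WSHD. (2) $\mathscr{F}[G]$ is OHD. (3) $\mathscr{F}[G]$ is UC. (4) $\mathscr{F}[G]$ is $\pi$-UC. (5) $G$ is OHD. (6) $G$ is UC. (7) $\chi(e,G)>\omega$. (8) $G$ is $\pi$-UC. (9) $\pi\chi(e,G)>\omega$.
   Context: For a topological space $X$, the Pixley-Roy hyperspace $\mathscr{F}[X]$ is the set of all non-empty finite subsets of $X$ with the topology having as a base all sets $[F,U]=\{H\in\mathscr{F}[X] : F\subseteq H\subseteq U\}$, where $F\in\mathscr{F}[X]$ and $U\subseteq X$ is open. Let $Y$ be a topological space. - $Y$ is WSHD if for every sequence $(U_n)_{n\in\omega}$ of non-empty open subsets of $Y$ there are an infinite $A\subseteq\omega$ and points $x_n\in U_n$ for $n\in A$ such that $(x_n)_{n\in A}$ has no convergent subsequence. - A sequence $(U_n)_{n\in\omega}$ of non-empty open sets converges to $y\in Y$ if for every open $U\ni y$ there is $m\in\omega$ with $U_n\subseteq U$ for all $n\geq m$. $Y$ is OHD if no sequence of non-empty open subsets of $Y$ converges to a point of $Y$. - A local $\pi$-basis for $y\in Y$ is a family $\mathscr{B}$ of non-empty open sets such that every open $U\ni y$ contains some $B\in\mathscr{B}$; it is a local base if moreover $y\in\bigcap\mathscr{B}$. $\chi(y,Y)$ (resp. $\pi\chi(y,Y)$) is the least cardinality of a local base (resp. local $\pi$-basis) for $y$ in $Y$. $Y$ is UC (resp. $\pi$-UC) if $\chi(y,Y)>\omega$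 (resp. $\pi\chi(y,Y)>\omega$) for every $y\in Y$. *)

(* Defs.v *)
From HB Require Import structures.
From mathcomp Require Import all_boot finmap.
From mathcomp Require Import boolp classical_sets functions cardinality.
From mathcomp Require Import topology.

Set Implicit Arguments.
Unset Strict Implicit.
Unset Printing Implicit Defensive.

Local Open Scope classical_set_scope.

(* Neither commutativity nor a separation axiom is built in. *)

HB.structure Definition PreTopologicalGroup :=
  {G of Topological G & Group G}.

HB.mixin Record PreTopologicalGroup_isTopologicalGroup G
    & PreTopologicalGroup G := {
  mulg_continuous : continuous (fun x : G * G => (x.1 * x.2)%g);
  invg_continuous : continuous (fun x : G => (x^-1)%g);
}.

#[short(type="topologicalGroupType")]
HB.structure Definition TopologicalGroup :=
  {G of PreTopologicalGroup G & PreTopologicalGroup_isTopologicalGroup G}.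

Section PixleyRoy.
Variable X : topologicalType.

Record pixley_roy := PixleyRoy {
  pr_fset : {fset X};
  _ : pr_fset != fset0
}.

HB.instance Definition _ := [isSub for pr_fset].
HB.instance Definition _ := [Choice of pixley_roy by <:].

(* The set [F, U]; it is empty when F is not included in U. *)
Definition pr_box (F : pixley_roy) (U : set X) : set pixley_roy :=
  [set H | [set` pr_fset F] `<=` [set` pr_fset H] /\ [set` pr_fset H] `<=` U].

Definition pr_boxes : set_system pixley_roy :=
  [set B | exists F U, open U /\ B = pr_box F U].

Let pr_boxes_cover : \bigcup_(B in pr_boxes) B = setT.
Proof.
apply/seteqP; split=> // H _; exists (pr_box H setT); last by split.
by exists H, setT; split=> //; exact: openT.
Qed.

Let pr_boxes_join (A B : set pixley_roy) (H : pixley_roy) :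
  pr_boxes A -> pr_boxes B -> A H -> B H ->
  exists C, [/\ pr_boxes C, C H & C `<=` A `&` B].
Proof.
move=> [F [U [oU ->]]] [F' [U' [oU' ->]]] [FH HU] [F'H HU'].
exists (pr_box H (U `&` U')); split.
- by exists H, (U `&` U'); split=> //; exact: openI.
- by split=> // x Hx; split; [exact: HU|exact: HU'].
- move=> K [HK KUU']; split; split=> x.
  + by move=> /FH /HK.
  + by move=> /KUU' [].
  + by move=> /F'H /HK.
  + by move=> /KUU' [].
Qed.

HB.instance Definition _ := isBaseTopological.Build pixley_roy
  pr_boxes_cover pr_boxes_join.

Lemma pr_boxes_basis : basis pr_boxes.
Proof.
split=> [B bB|H A].
  by exists [set B]; [move=> _ ->|rewrite bigcup_set1].
move=> [_ [[D sD <-] [B DB BH] sA]].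
by exists B; [split=> //; exact: sD|move=> K BK; apply: sA; exists B].
Qed.

End PixleyRoy.

Section Properties.
Variable Y : topologicalType.

Definition nonempty_open (U : set Y) := open U /\ U !=set0.

(* A subsequence of (x_n)_{n in A} is x \o f with f : nat -> nat strictly     *)
(* increasing and valued in A; the values of x outside of A are irrelevant.   *)
Definition has_convergent_subseq (A : set nat) (x : nat -> Y) :=
  exists f : nat -> nat, [/\ {homo f : m n / (m < n)%N},
    (forall k, A (f k)) & exists y : Y, (x \o f) @ \oo --> y].

Definition WSHD := forall U : nat -> set Y,
  (forall n, nonempty_open (U n)) ->
  exists (A : set nat) (x : nat -> Y), [/\ infinite_set A,
    (forall n, A n -> U n (x n)) & ~ has_convergent_subseq A x].

Definition open_seq_cvg (U : nat -> set Y) (y : Y) :=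
  forall V : set Y, open V -> V y ->
    exists m : nat, forall n, (m <= n)%N -> U n `<=` V.

Definition OHD := ~ exists (U : nat -> set Y) (y : Y),
  (forall n, nonempty_open (U n)) /\ open_seq_cvg U y.

Definition local_pi_base (y : Y) (B : set_system Y) :=
  B `<=` nonempty_open /\
  forall U, open U -> U y -> exists2 V, B V & V `<=` U.

Definition local_base (y : Y) (B : set_system Y) :=
  local_pi_base y B /\ forall V, B V -> V y.

(* Cardinals are represented by sets: the least cardinality of a member of P  *)
(* is the cardinality of any A such that least_card P A.                      *)
Definition least_card T (P : set (set T)) (A : set T) :=
  P A /\ forall B, P B -> (A #<= B)%card.

Definition least_card_gt_omega T (P : set (set T)) :=
  exists2 A, least_card P A & ~ countable A.

Definition character_gt_omega (y : Y) := least_card_gt_omega (local_base y).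

Definition pi_character_gt_omega (y : Y) :=
  least_card_gt_omega (local_pi_base y).

Definition UC := forall y : Y, character_gt_omega y.

Definition pi_UC := forall y : Y, pi_character_gt_omega y.

End Properties.

Arguments WSHD : clear implicits.
Arguments OHD : clear implicits.
Arguments UC : clear implicits.
Arguments pi_UC : clear implicits.

(* Main.v *)
(* In a group, a countable local pi-base (V_n) at one point y yields the     *)
(* countable local base (z V_n^-1 V_n) at any point z, so all conditions on G *)
(* say that no point of G has a countable local base.  A countable local      *)
(* pi-base at F in F[X] gives countably many neighbourhoods W_n of F cofinal  *)
(* among all neighbourhoods of F, hence, X being Hausdorff, a countable local *)
(* base at each point of F.  For WSHD, given boxes [F_n, O_n] with F_n -> F   *)
(* along a subsequence, the O_n cannot converge to F; so some open V          *)
(* containing F fails to include infinitely many O_n, and adding to these F_n *)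
(* a point x_n of O_n outside V, no value being repeated infinitely often,    *)
(* destroys all convergent subsequences: a limit would have to lie inside F,  *)
(* and then x_n would eventually be in V.                                     *)

Require Import Defs.
From mathcomp Require Import all_boot finmap.
From mathcomp Require Import boolp classical_sets functions cardinality.
From mathcomp Require Import topology.

Set Implicit Arguments.
Unset Strict Implicit.
Unset Printing Implicit Defensive.

Local Open Scope classical_set_scope.

(** The nine conditions form one cycle. Least cardinals are attained, so uncountable (pi-)character
    just means that no countable local (pi-)base exists ([least_card_gt_omegaP]). In any space WSHD
    gives OHD, and OHD gives UC, since a countable local base yields a convergent sequence of open
    sets. Countability passes from a point of [G] up to its singleton
    ([countable_local_base_singleton]) and from a local pi-base at [F] down to a local base at each
    point of [F] ([countable_local_pi_base_point]). Inside [G], translations and division identify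
    bases with pi-bases and all points with each other ([topological_group_countable_base]). The
    cycle closes with [UC_pixley_roy_WSHD], where one extra point added to each chosen finite set
    destroys convergence. *)

Section LeastCardinality.

(** * Existence of least cardinalities *)

Variable T : Type.
Implicit Types P : set (set T).

(* Zorn's lemma is applied to sets of choice functions on P that are pairwise *)
(* distinct at every member of P; some evaluation map is then onto.           *)
Lemma least_card_exists P : P !=set0 -> exists A, least_card P A.
Proof.
move=> [A0 PA0].
pose Q := [set S : set (set T -> T) | forall s, S s -> forall A, P A ->
  A (s A) /\ forall t, S t -> s A = t A -> s = t].
have [|S [QS Smax]] := @Zorn_bigcup _ Q.
  move=> C CQ totC s [S CS Ss] A PA; split; first by have [] := CQ _ CS _ Ss _ PA.
  move=> t [S' CS' S't] st; have [SS'|S'S] := totC _ _ CS CS'.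
    by have [_] := CQ _ CS' _ (SS' _ Ss) _ PA; exact.
  by have [_] := CQ _ CS _ Ss _ PA; apply => //; exact: S'S.
(* If evaluation at [A] maps [S] onto [A], then sending [s A] to [s B] embeds [A] into every [B] in
   [P]. *)
have [[A [PA SA]]|nA] :=
    pselect (exists A, P A /\ forall a, A a -> exists2 s, S s & s A = a).
  exists A; split => // B PB.
  have /choice[g gP] (a : T) : exists s, A a -> S s /\ s A = a.
    have [/SA[s Ss sa]|nAa] := pselect (A a); first by exists s.
    by exists (fun=> a).
  have injh : {in A &, injective (fun a => g a B)}.
    move=> a b; rewrite !inE => Aa Ab gab.
    have [[Sa <-] [Sb <-]] := (gP a Aa, gP b Ab).
    by have [_ /(_ _ Sb gab) ->] := QS _ Sa _ PB.
  have -> : (A #<= B)%card = ((fun a => g a B) @` A #<= B)%card.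
    by apply/card_le_eql; rewrite card_eq_sym; exact: inj_card_eq.
  apply: subset_card_le => _ [a Aa <-].
  by have [Sa _] := gP a Aa; have [] := QS _ Sa _ PB.
have miss A : P A -> exists a, A a /\ forall s, S s -> s A <> a.
  move=> PA; apply: contrapT => h; apply: nA; exists A; split=> // a Aa.
  by apply: contrapT => k; apply: h; exists a; split=> // s Ss sa; apply: k; exists s.
(* Otherwise the missed values assemble into a choice function [t] that extends [S], against
   maximality. *)
have [a0 _] := miss _ PA0.
have /choice[t tP] (A : set T) :
    exists a, P A -> A a /\ forall s, S s -> s A <> a.
  have [/miss[a aP]|nPA] := pselect (P A); first by exists a.
  by exists a0.
exfalso; apply: (Smax (S `|` [set t])).
  split; first by move=> s Ss; left.
  by move=> /(_ t (or_intror erefl)) St; have [_ /(_ _ St)] := tP _ PA0; exact.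
move=> s [Ss|->] A PA; have [At tA] := tP _ PA; split=> //.
- by have [] := QS _ Ss _ PA.
- by move=> u [Su|->] su; [have [_] := QS _ Ss _ PA; exact|case: (tA _ Ss)].
- by move=> u [Su|->] su //; case: (tA _ Su).
Qed.

(** A least member embeds into all the others, so it is countable as soon as one of them is. *)
Lemma least_card_gt_omegaP P : P !=set0 ->
  least_card_gt_omega P <-> ~ exists2 A, P A & countable A.
Proof.
move=> P0; split=> [[A [PA leA] ncA] [B PB cB]|nP].
  by apply: ncA; exact: sub_countable (leA _ PB) cB.
have [A lA] := least_card_exists P0; exists A => // cA; apply: nP.
by exists A => //; case: lA.
Qed.

End LeastCardinality.

(** * Infinite sets and sequences of indices *)

Lemma infinite_natP (A : set nat) :
  infinite_set A <-> forall m, exists2 n, (m <= n)%N & A n.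
Proof.
split=> [infA m|ubA finA].
  apply: contrapT => nA; apply: infA.
  apply: (sub_finite_set _ (finite_II m)) => n An /=.
  by rewrite ltnNge; apply/negP => mn; apply: nA; exists n.
have /finite_fsetP[X AX] := finA.
have [n + An] := ubA (\max_(i <- X) i).+1; rewrite ltnNge => /negP; apply.
by apply: leq_bigmax_seq => //; move: An; rewrite AX.
Qed.

Lemma homo_ltn_ge (f : nat -> nat) :
  {homo f : m n / (m < n)%N} -> forall k, (k <= f k)%N.
Proof. by move=> hf; elim=> // k IH; exact: leq_ltn_trans IH (hf _ _ _). Qed.

Lemma homo_ltn_cofinal (f : nat -> nat) : {homo f : m n / (m < n)%N} ->
  forall k n, (f k <= f n)%N -> (k <= n)%N.
Proof.
by move=> hf k n; rewrite leqNgt => h; rewrite leqNgt; apply: contra h; exact: hf.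
Qed.

(** Points are chosen recursively, each outside the finite list [prev n] of its predecessors. *)
Lemma infinite_injective_choice (T : choiceType) (S : nat -> set T) :
  (forall n, infinite_set (S n)) ->
  exists2 x : nat -> T, injective x & forall n, S n (x n).
Proof.
move=> infS.
have /choice[pick pickP] (p : nat * seq T) : exists y, S p.1 y /\ y \notin p.2.
  apply: contrapT => nex; apply: (infS p.1).
  apply: (sub_finite_set _ (finite_seq p.2)) => y Sy /=.
  by apply: contrapT => /negP yp; apply: nex; exists y.
pose fix prev n := if n is k.+1 then pick (k, prev k) :: prev k else [::].
pose x n := pick (n, prev n).
have prevP m n : (m < n)%N -> x m \in prev n.
  elim: n => // n IH; rewrite ltnS leq_eqVlt => /predU1P[->|/IH h].
    exact: mem_head.
  by rewrite /= inE h orbT.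
have xneq m n : (m < n)%N -> x m <> x n.
  move=> /prevP mn xmn; have [_ /=] := pickP (n, prev n).
  by rewrite -/(x n) -xmn mn.
exists x => [m n xmn|n]; last by have [] := pickP (n, prev n).
by case: (ltngtP m n) => [/xneq|/xneq/nesym|].
Qed.

(** * Countable local bases and convergent sequences of open sets *)

Section CountableBases.
Variable Y : topologicalType.
Implicit Types (y : Y) (U V : set Y).

Definition countable_local_base y := exists2 B, local_base y B & countable B.

Definition countable_local_pi_base y :=
  exists2 B, local_pi_base y B & countable B.

Lemma local_base_open_nbhs y : local_base y (open_nbhs y).
Proof.
split=> [|V []//]; split=> [V [oV Vy]|U oU Uy]; first by split=> //; exists y.
by exists U.
Qed.

Lemma character_gt_omegaP y :
  character_gt_omega y <-> ~ countable_local_base y.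
Proof.
apply: least_card_gt_omegaP; exists (open_nbhs y).
exact: local_base_open_nbhs.
Qed.

Lemma pi_character_gt_omegaP y :
  pi_character_gt_omega y <-> ~ countable_local_pi_base y.
Proof.
apply: least_card_gt_omegaP; exists (open_nbhs y).
by have [] := local_base_open_nbhs y.
Qed.

Lemma countable_local_base_pi y :
  countable_local_base y -> countable_local_pi_base y.
Proof. by case=> B [bB _] cB; exists B. Qed.

Lemma cvg_openP (x : nat -> Y) y : x @ \oo --> y <->
  forall V, open V -> V y -> exists m, forall n, (m <= n)%N -> V (x n).
Proof.
split=> [xy V oV Vy|xy V].
  by have [m _ mV] := xy V (open_nbhs_nbhs (conj oV Vy)); exists m.
rewrite nbhsE => -[U [oU Uy] UV]; have [m mU] := xy _ oU Uy.
by exists m => // n mn; apply: UV; exact: mU.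
Qed.

Lemma open_seq_cvg_pi_base (U : nat -> set Y) y :
  (forall n, nonempty_open (U n)) -> open_seq_cvg U y ->
  countable_local_pi_base y.
Proof.
move=> oU Uy; exists (range U).
  split=> [_ [n _ <-]//|V oV Vy].
  have [m mV] := Uy V oV Vy; exists (U m); first by exists m.
  exact: mV.
exact: sub_countable (card_image_le _ _) (countableP _).
Qed.

Lemma countable_local_base_seq y : countable_local_base y ->
  exists2 U : nat -> set Y, forall n, nonempty_open (U n) & open_seq_cvg U y.
Proof.
move=> [B [[oB bB] By] /countable_injP[f finj]].
have /choice[e eP] k : exists V, open_nbhs y V /\
    forall W, B W -> f W = k -> W = V.
  have [[V [BV fV]]|nV] := pselect (exists V, B V /\ f V = k).
    exists V; split; first by split; [have [] := oB _ BV|exact: By].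
    by move=> W BW fW; apply: finj; rewrite ?inE// fV.
  exists setT; split; first exact: open_nbhsT.
  by move=> W BW fW; exfalso; apply: nV; exists W.
exists (fun n => \big[setI/setT]_(k < n) e k) => [n|V oV Vy].
  have [oI Iy] : open_nbhs y (\big[setI/setT]_(k < n) e k).
    apply: big_ind => [|A C nA nC|k _]; first exact: open_nbhsT.
      exact: open_nbhsI.
    by have [] := eP k.
  by split=> //; exists y.
have [W BW WV] := bB V oV Vy; exists (f W).+1 => n fWn.
rewrite -bigcap_mkord => z /(_ (f W) fWn) ez; apply: WV.
by have [_ /(_ _ BW erefl) ->] := eP (f W).
Qed.

End CountableBases.

Lemma OHD_UC (Y : topologicalType) : OHD Y -> UC Y.
Proof.
move=> ohd y; apply/character_gt_omegaP => /countable_local_base_seq[U oU Uy].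
by apply: ohd; exists U, y.
Qed.

Lemma WSHD_OHD (Y : topologicalType) : WSHD Y -> OHD Y.
Proof.
move=> wshd [U [y [oU Uy]]]; have [A [x [infA Ux]]] := wshd U oU; apply.
have /choice[g gP] (m : nat) : exists n, (m < n)%N /\ A n.
  by have /infinite_natP/(_ m.+1)[n mn An] := infA; exists n.
(* At least one application of [g] is needed, since the starting value 0 may lie outside [A]. *)
pose f k := iter k.+1 g 0%N.
have fS k : (f k < f k.+1)%N by have [] := gP (f k).
have fA k : A (f k) by have [] := gP (iter k g 0%N).
have fmono : {homo f : m n / (m < n)%N} by apply: homo_ltn => //; exact: ltn_trans.
exists f; split=> //; exists y; apply/cvg_openP => V oV Vy.
have [m mV] := Uy V oV Vy; exists m => n mn.
by apply: (mV (f n)); [exact: leq_trans mn (homo_ltn_ge fmono n)|exact: Ux].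
Qed.

(** * Countable local bases in topological groups *)

Lemma topological_group_countable_base (G : topologicalGroupType) (y z : G) :
  countable_local_pi_base y -> countable_local_base z.
Proof.
move=> [B [oB bB] cB].
(* This is $z V^{-1} V$, written as a union of translates so that it is visibly open; it contains
   [z] even when [V] misses [y]. *)
pose D (V : set G) := \bigcup_(a in V) [set b | V (a * (z^-1 * b))%g].
have cmul (a : G) : continuous (fun b : G => a * b)%g.
  move=> b; apply: (@continuous2_cvg _ _ _ _ _ _ (fun=> a) id (fun u v => u * v)%g).
  - exact: (@mulg_continuous G (a, b)).
  - exact: cvg_cst.
  - exact: cvg_id.
exists (D @` B); last exact: sub_countable (card_image_le _ _) cB.
have DP V : B V -> open (D V) /\ D V z.
  move=> /oB[oV [a Va]]; split; last by exists a => //=; rewrite mulVg mulg1.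
  apply: bigcup_open => c _.
  have -> : [set b | V (c * (z^-1 * b))%g] = (fun b : G => c * z^-1 * b)%g @^-1` V.
    by apply/seteqP; split=> b /=; rewrite mulgA.
  by apply: open_comp => // b _; exact: cmul.
split; last by move=> _ [V /DP[_ Dz] <-].
split=> [_ [V /DP[oD Dz] <-]|U oU Uz]; first by split=> //; exists z.
(* Continuity at [(y, y)] makes [D V] small once [V] lies in a small neighbourhood of [y]. *)
have /= cq : (fun p : G * G => z * (p.1^-1 * p.2))%g @ (y, y) --> (z * (y^-1 * y))%g.
  apply: (@continuous_comp _ _ _ (fun p : G * G => p.1^-1 * p.2)%g (fun b => z * b)%g (y, y)); last exact: cmul.
  apply: (@continuous2_cvg _ _ _ _ _ _ (fun p : G * G => p.1^-1)%g snd (fun u v => u * v)%g).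
  - exact: (@mulg_continuous G (_, _)).
  - apply: (@continuous_comp _ _ _ fst (fun b : G => b^-1)%g (y, y)).
      exact: cvg_fst.
    exact: invg_continuous.
  - exact: cvg_snd.
have : nbhs (z * (y^-1 * y))%g U.
  by apply: open_nbhs_nbhs; split=> //; rewrite mulVg mulg1.
move=> /cq[[P Q] /= [nP nQ] PQ].
have : nbhs y (P `&` Q) by exact: filterI.
rewrite nbhsE => -[W [oW Wy] WPQ]; have [V BV VW] := bB W oW Wy.
exists (D V); first by exists V.
move=> b [a Va /= Vb].
have [Pa _] := WPQ _ (VW _ Va); have [_ Qb] := WPQ _ (VW _ Vb).
have := PQ (a, a * (z^-1 * b))%g (conj Pa Qb).
by rewrite /= mulKg mulVKg.
Qed.

(** * Separation of points from finite sets *)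

Section HausdorffSpaces.
Variable X : topologicalType.
Hypothesis hX : hausdorff_space X.

Lemma hausdorff_separate_seq (h : X) (s : seq X) : h \notin s ->
  exists N V : set X, [/\ open N, N h, open V, (forall a, a \in s -> V a) &
    forall z, N z -> ~ V z].
Proof.
elim: s => [_|a s IH].
  by exists setT, set0; split=> //; [exact: openT|exact: open0|move=> z _ []].
rewrite inE negb_or => /andP[ha /IH[N [V [oN Nh oV sV NV]]]].
have := hX; rewrite open_hausdorff => /(_ _ _ ha)[[C D]] /= [].
rewrite !inE => Ch Da [oC oD CD].
exists (N `&` C), (V `|` D); split.
- exact: openI.
- by [].
- exact: openU.
- by move=> b; rewrite inE => /predU1P[->|/sV]; [right|left].
- move=> z [Nz Cz] [|Dz]; first exact: NV.
  by suff : (set0 : set X) z by []; rewrite -CD.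
Qed.

(** Finite sets are closed, so a finite open [U] would make [h] isolated, with a one-element local
    base. *)
Lemma open_infinite (h : X) (U : set X) : ~ countable_local_base h ->
  open U -> U h -> infinite_set U.
Proof.
move=> nh oU Uh finU; apply: nh; exists [set [set h]]; last exact: countable1.
have o1 : open [set h].
  have -> : [set h] = U `&` ~` (U `\ h).
    apply/seteqP; split=> [_ -> /=|z /= [Uz nz]]; first by split=> // -[_ /(_ erefl)].
    by apply: contrapT => zh; apply: nz.
  apply: openI => //; apply: closed_openC.
  have := hausdorff_accessible hX.
  move/accessible_finite_set_closed; apply.
  exact: finite_setD.
split; last by move=> _ ->.
split=> [_ ->|V oV Vh]; first by split=> //; exists h.
by exists [set h] => // _ ->.
Qed.

(* A set F \ {x} lies in an open set V disjoint from a neighbourhood N of x;  *)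
(* traces on N of neighbourhoods of F then recover the neighbourhoods of x.   *)
Lemma countable_nbhs_base_finite (F : seq X) (x : X) (W : set_system X) :
  x \in F -> countable W -> (forall B, W B -> open B /\ B x) ->
  (forall V, open V -> (forall a, a \in F -> V a) -> exists2 B, W B & B `<=` V) ->
  countable_local_base x.
Proof.
move=> xF cW oW bW.
have [|N [V [oN Nx oV FV NV]]] :=
    @hausdorff_separate_seq x [seq a <- F | a != x].
  by rewrite mem_filter eqxx.
exists ((fun B => B `&` N) @` W); last exact: sub_countable (card_image_le _ _) cW.
split; last by move=> _ [B /oW[_ Bx] <-].
split=> [_ [B /oW[oB Bx] <-]|U oU Ux]; first by split; [exact: openI|exists x].
have [|a aF|B WB BUV] := bW (U `|` V); first exact: openU.
  have [->|ax] := eqVneq a x; first by left.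
  by right; apply: FV; rewrite mem_filter ax.
exists (B `&` N); first by exists B.
by move=> z [/BUV[//|Vz] /NV].
Qed.

End HausdorffSpaces.

(** * The Pixley-Roy hyperspace *)

Section PixleyRoyHyperspace.
Variable X : topologicalType.
Implicit Types (F H : pixley_roy X) (U V : set X).

Lemma open_pr_box F U : open U -> open (pr_box F U).
Proof. by move=> oU; apply: (pr_boxes_basis X).1; exists F, U. Qed.

(** Raising the lower end of a basic box to [H] only shrinks the box. *)
Lemma open_pixley_royP (A : set (pixley_roy X)) H : open A -> A H ->
  exists U, [/\ open U, [set` pr_fset H] `<=` U & pr_box H U `<=` A].
Proof.
move=> oA AH; have := (pr_boxes_basis X).2 H A (open_nbhs_nbhs (conj oA AH)).
move=> [_ [[F [U [oU ->]]] [FH HU]] sA]; exists U; split=> // K [HK KU].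
by apply: sA; split=> // a /FH /HK.
Qed.

Lemma pixley_roy_neq0 F : exists x, x \in pr_fset F.
Proof. by apply/fset0Pn; case: F. Qed.

Lemma fset1_neq0 (x : X) : [fset x]%fset != fset0.
Proof. by apply/fset0Pn; exists x; rewrite inE. Qed.

Definition pr_singleton (x : X) := PixleyRoy (fset1_neq0 x).

Lemma pr_add_proof (x : X) F : (x |` pr_fset F)%fset != fset0.
Proof. by apply/fset0Pn; exists x; rewrite !inE eqxx. Qed.

Definition pr_add (x : X) F := PixleyRoy (pr_add_proof x F).

Lemma countable_local_base_singleton (x : X) :
  countable_local_base x -> countable_local_base (pr_singleton x).
Proof.
move=> [B [[oB bB] Bx] cB].
exists (pr_box (pr_singleton x) @` B);
  last exact: sub_countable (card_image_le _ _) cB.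
have boxx V : V x -> pr_box (pr_singleton x) V (pr_singleton x).
  by move=> Vx; split=> //= a /=; rewrite inE => /eqP ->.
split; last by move=> _ [V /Bx Vx <-]; exact: boxx.
split=> [_ [V BV <-]|A oA /(open_pixley_royP oA)[U [oU xU UA]]].
  split; first by apply: open_pr_box; have [] := oB _ BV.
  by exists (pr_singleton x); apply: boxx; exact: Bx.
have [|V BV VU] := bB U oU; first by apply: xU; rewrite /= inE.
exists (pr_box (pr_singleton x) V); first by exists V.
by move=> K [xK KV]; apply: UA; split=> // a /KV /VU.
Qed.

Hypothesis hX : hausdorff_space X.

Lemma countable_local_pi_base_point F x : x \in pr_fset F ->
  countable_local_pi_base F -> countable_local_base x.
Proof.
move=> xF [B [oB bB] cB].
have /choice[w wP] (A : set (pixley_roy X)) : exists HU : pixley_roy X * set X,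
    B A -> [/\ open HU.2, [set` pr_fset HU.1] `<=` HU.2 & pr_box HU.1 HU.2 `<=` A].
  have [/oB[oA [H AH]]|nBA] := pselect (B A); last by exists (F, set0).
  by have [U UP] := open_pixley_royP oA AH; exists (H, U).
apply: (@countable_nbhs_base_finite _ hX (pr_fset F) x
    ((fun A => (w A).2) @` [set A | B A /\ [set` pr_fset F] `<=` (w A).2])) => //.
- apply: (sub_countable (card_image_le _ _)); apply: sub_countable cB.
  by apply: subset_card_le => A [].
- by move=> _ [A [BA FA] <-]; have [oA _ _] := wP _ BA; split=> //; exact: FA.
move=> V oV FV; have [||A BA AV] := bB (pr_box F V); first exact: open_pr_box.
  by split=> // a /FV.
have [oW HW WA] := wP _ BA; have /AV[FH HV] : A (w A).1 by apply: WA; split.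
exists (w A).2; first by exists A => //; split=> // a /FH /HW.
move=> z Wz.
(* Adding [z] to the lower end keeps it in the box, hence inside [[F, V]]; this forces [z] into
   [V]. *)
have /WA /AV[_] : pr_box (w A).1 (w A).2 (pr_add z (w A).1).
  split=> a /=; first by rewrite !inE => ->; rewrite orbT.
  by rewrite !inE => /predU1P[->//|/HW].
by apply; rewrite /= !inE eqxx.
Qed.

Lemma UC_pixley_roy_WSHD :
  (forall x : X, ~ countable_local_base x) -> WSHD (pixley_roy X).
Proof.
move=> ncX U oU.
have /choice[F UF] n : exists H, U n H by have [_] := oU n.
have /choice[O OP] n : exists V : set X,
    [/\ open V, [set` pr_fset (F n)] `<=` V & pr_box (F n) V `<=` U n].
  by have [oUn _] := oU n; exact: open_pixley_royP.
have [[f [fmono _ [F0 fF0]]]|nF] := pselect (has_convergent_subseq setT F);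
  last by exists setT, F; split=> //; exact: infinite_nat.
pose B := range f.
have evF V : open V -> [set` pr_fset F0] `<=` V -> exists m, forall n,
    (m <= n)%N -> B n ->
    [set` pr_fset F0] `<=` [set` pr_fset (F n)] /\ [set` pr_fset (F n)] `<=` V.
  move=> oV F0V; have /cvg_openP/(_ _ (open_pr_box F0 oV))[|m mP] := fF0; first by split.
  by exists (f m) => _ /[swap] -[k _ <-] /(homo_ltn_cofinal fmono)/mP.
have [m0 m0P] : exists m0, forall n, (m0 <= n)%N -> B n -> [set` pr_fset F0] `<=` O n.
  have [|m mP] := evF setT openT; first by [].
  by exists m => n mn Bn a /(mP n mn Bn).1; have [_ FO _] := OP n; exact: FO.
have infB : infinite_set B.
  apply/infinite_natP => m; exists (f m); last by exists m.
  exact: homo_ltn_ge.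
have [x0 x0F0] := pixley_roy_neq0 F0.
(* Otherwise the sets [O n] with [n] in [B] and [m0 <= n] would be cofinal among the neighbourhoods
   of [F0], giving [x0] a countable local base. *)
have [V0 [oV0 F0V0 infV0]] : exists V, [/\ open V, [set` pr_fset F0] `<=` V &
    infinite_set [set n | B n /\ ~ O n `<=` V]].
  apply: contrapT => nV; apply: (ncX x0).
  apply: (@countable_nbhs_base_finite _ hX (pr_fset F0) x0
    (O @` [set n | B n /\ (m0 <= n)%N])) => //.
  - exact: sub_countable (card_image_le _ _) (countableP _).
  - move=> _ [n [Bn mn] <-]; have [oO _ _] := OP n; split=> //.
    exact: (m0P n mn Bn).
  move=> V oV F0V; apply: contrapT => nO; apply: nV; exists V; split=> //.
  apply/infinite_natP => m.
  have /infinite_natP/(_ (maxn m m0))[n] := infB.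
  rewrite geq_max => /andP[mn m0n] Bn; exists n => //; split=> // OV.
  by apply: nO; exists (O n) => //; exists n.
have [V [A [x [oV F0V [AB infA] Ox finx]]]] : exists V A (x : nat -> X),
   [/\ open V, [set` pr_fset F0] `<=` V, A `<=` B /\ infinite_set A,
    forall n, A n -> O n (x n) /\ ~ V (x n) &
    forall h, finite_set [set n | A n /\ x n = h]].
  have /choice[x xP] n : exists z, ~ O n `<=` V0 -> O n z /\ ~ V0 z.
    have [|/existsNP[z /not_implyP[Oz Vz]]] := pselect (O n `<=` V0).
      by exists x0.
    by exists z.
  set A := [set n | _] in infV0.
  (* If x takes a value h infinitely often, replace these x n by distinct   *)
  (* points of O n close to h; they exist because h is not isolated.        *)
  have [finx|/existsNP[h infh]] :=
      pselect (forall h, finite_set [set n | A n /\ x n = h]).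
    exists V0, A, x; split=> //; first by split=> // n [].
    by move=> n [_ /xP].
  have hO n : A n /\ x n = h -> O n h /\ ~ V0 h by move=> [[_ /xP] + <-].
  have [n0 /hO[_ nVh]] := infinite_setN0 infh.
  have [|N [V' [oN Nh oV' F0V' NV']]] := @hausdorff_separate_seq _ hX h (pr_fset F0).
    by apply/negP => /F0V0.
  (* The choice of [y] needs an infinite set at every index; the default [setT] serves those with
     [h] outside [O n], which are discarded afterwards. *)
  pose S n := N `&` (if `[<O n h>] then O n else setT).
  have [y yinj yS] : exists2 y : nat -> X, injective y & forall n, S n (y n).
    apply: infinite_injective_choice => n.
    apply: (@open_infinite _ hX h) => //; rewrite /S; case: asboolP => // Onh.
    - by apply: openI => //; have [] := OP n.
    - by apply: openI => //; exact: openT.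
  exists V', [set n | A n /\ x n = h], y; split=> //.
  - by split=> // n [[]].
  - move=> n /hO[Oh _]; have [Ny] := yS n; rewrite asboolT// => Oy.
    by split=> //; exact: NV'.
  move=> b; have [[k yk]|nk] := pselect (exists k, y k = b).
    apply: (sub_finite_set _ (finite_set1 k)) => n [_ yn].
    by apply: yinj; rewrite yk.
  by apply: (sub_finite_set _ (finite_set0 _)) => n [_ yn]; apply: nk; exists n.
exists A, (fun n => pr_add (x n) (F n)); split=> // [n An|].
  have [_ FO OU] := OP n; apply: OU; split=> a /=.
    by rewrite !inE => ->; rewrite orbT.
  by rewrite !inE => /predU1P[->|/FO//]; have [] := Ox n An.
move=> [g [gmono gA [H gH]]].
have evH W : open W -> [set` pr_fset H] `<=` W -> exists m, forall k, (m <= k)%N ->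
    [set` pr_fset H] `<=` [set` pr_fset (pr_add (x (g k)) (F (g k)))] /\
    [set` pr_fset (pr_add (x (g k)) (F (g k)))] `<=` W.
  move=> oW HW; have /cvg_openP/(_ _ (open_pr_box H oW))[|m mP] := gH; first by split.
  by exists m => k /mP.
(* A point [a] of [H] outside [F0] is eventually missed by the sets [F (g k)], so it must be the
   added point infinitely often, against [finx]. *)
have HF0 : [set` pr_fset H] `<=` [set` pr_fset F0].
  move=> a /= aH; apply: contrapT => /negP aF0.
  have [N [W [_ Na oW F0W NW]]] := hausdorff_separate_seq hX aF0.
  have [m1 m1P] := evF W oW F0W.
  have [|m2 m2P] := evH setT openT; first by [].
  apply: (_ : infinite_set [set n | A n /\ x n = a]) (finx a).
  apply/infinite_natP => m; pose k := maxn m (maxn m1 m2).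
  have [mk m1k m2k] : [/\ m <= k, m1 <= k & m2 <= k]%N.
    by rewrite /k; split; rewrite !leq_max leqnn ?orbT.
  exists (g k); first exact: leq_trans mk (homo_ltn_ge gmono k).
  split; first exact: gA.
  have [/(_ _ aH) + _] := m2P k m2k; rewrite /= !inE => /predU1P[//|aFg].
  have [_ /(_ _ aFg)] := m1P (g k) (leq_trans m1k (homo_ltn_ge gmono k)) (AB _ (gA k)).
  by move/(NW _ Na).
(* Now [V] is a neighbourhood of [H], so the added points end up in [V], although they were all
   chosen outside it. *)
have [|m mP] := evH V oV; first by move=> a /HF0 /F0V.
have [_ /(_ (x (g m)))] := mP m (leqnn m).
by rewrite /= !inE eqxx => /(_ isT); have [] := Ox _ (gA m).
Qed.

End PixleyRoyHyperspace.

Theorem theorem12 (G : topologicalGroupType) (hG : hausdorff_space G) :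
  [<-> WSHD (pixley_roy G);
       OHD (pixley_roy G);
       UC (pixley_roy G);
       pi_UC (pixley_roy G);
       OHD G;
       UC G;
       character_gt_omega (1%g : G);
       pi_UC G;
       pi_character_gt_omega (1%g : G)].
Proof.
have UCG : UC (pixley_roy G) -> forall x : G, ~ countable_local_base x.
  move=> uc x /countable_local_base_singleton.
  by apply/character_gt_omegaP.
tfae.
- exact: WSHD_OHD.
- exact: OHD_UC.
- move=> /UCG ncG F; apply/pi_character_gt_omegaP => cF.
  have [x xF] := pixley_roy_neq0 F.
  by apply: (ncG x); exact: (countable_local_pi_base_point hG xF cF).
(* The sets [U n] form a countable local pi-base at [y]; the group turns it into a local base, which
   the singleton of [y] inherits. *)
- move=> piuc [U [y [oU Uy]]].
  have cy : countable_local_base y.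
    exact: topological_group_countable_base (open_seq_cvg_pi_base oU Uy).
  have /pi_character_gt_omegaP := piuc (pr_singleton y); apply.
  by apply: countable_local_base_pi; exact: countable_local_base_singleton.
- exact: OHD_UC.
- exact.
- move=> /character_gt_omegaP nc y; apply/pi_character_gt_omegaP => cy.
  by apply: nc; exact: topological_group_countable_base cy.
- exact.
- move=> /pi_character_gt_omegaP nc; apply: UC_pixley_roy_WSHD => // x.
  move/countable_local_base_pi/(topological_group_countable_base 1%g).
  by move/countable_local_base_pi.
Qed.
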